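(* Let $k\ge 3$ and let $G$ be a $(1,1,k;-1)$-graph, i.e. a mixed graph with maximum undirected degree $1$, maximum directed out-degree $1$, diameter $k$ and order $M(1,1,k)-1$. Then $G$ is totally regular.
   Context: A mixed graph $G$ consists of a finite set $V(G)$ of vertices, a set $E(G)$ of unordered pairs of vertices (edges, $u\sim v$) and a set $A(G)$ of ordered pairs (arcs, $u\to v$). There are no loops and no parallel edges or arcs, and $u\sim v$ and $u\to v$ cannot hold simultaneously. Mixed graphs are assumed proper: both $E(G)$ and $A(G)$ are non-empty. The undirected degree of $u$ is $d(u)=|\{v:u\sim v\}|$, the directed out-degree is $d^+(u)=|\{v:u\to v\}|$ and the directed in-degree is $d^-(u)=|\{v:v\to u\}|$. The distance from $u$ to $v$ is the length of a shortest path from $u$ to $v$, where each step follows an edge (in either direction) or an arc (in its direction); the diameter is $\max\{d(u,v):u,v\in V(G)\}$. The mixed Moore bound for $r=z=1$ is $M(1,1,k)=F_{k+3}-2$, where $F_0=F_1=1$ and $F_{j+2}=F_{j+1}+F_j$; thus a $(1,1,k;-1)$-graph has order $F_{k+3}-3$. $G$ is out-regular if $d(u)=d(v)$ and $d^+(u)=d^+(v)$ for all vertices $u,v$; it is totally regular if it is out-regular and $d^-(u)=d^+(u)$ for every vertex $u$. *)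

(* Defs.v *)
From mathcomp Require Import all_boot.

Set Implicit Arguments.
Unset Strict Implicit.
Unset Printing Implicit Defensive.

(* Opposite arcs u -> v and v -> u are distinct ordered pairs, hence not
   parallel, so they are not excluded. *)
Record mixed_graph (V : finType) := MixedGraph {
  edge : rel V;
  arc : rel V;
  edge_sym : symmetric edge;
  edge_irr : irreflexive edge;
  arc_irr : irreflexive arc;
  edge_not_arc : forall u v, edge u v -> ~~ arc u v
}.

Section MixedGraphs.
Variables (V : finType) (G : mixed_graph V).

Definition proper_mixed : Prop :=
  (exists u v, edge G u v) /\ (exists u v, arc G u v).

Definition deg (u : V) : nat := #|[set v | edge G u v]|.
Definition outdeg (u : V) : nat := #|[set v | arc G u v]|.
Definition indeg (u : V) : nat := #|[set v | arc G v u]|.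

Definition max_deg : nat := \max_(u : V) deg u.
Definition max_outdeg : nat := \max_(u : V) outdeg u.

Definition step : rel V := [rel u v | edge G u v || arc G u v].

Definition path_of_length (u v : V) (n : nat) : Prop :=
  exists p : seq V, [/\ path step u p, last u p = v & size p = n].

(* Relational, so that no value has to be given to unreachable pairs. *)
Definition is_distance (u v : V) (n : nat) : Prop :=
  path_of_length u v n /\ forall m, path_of_length u v m -> n <= m.

(* Every distance is finite and the largest one is k. *)
Definition is_diameter (k : nat) : Prop :=
  (forall u v, exists2 n, is_distance u v n & n <= k) /\
  (exists u v, is_distance u v k).

Definition out_regular : Prop :=
  forall u v, deg u = deg v /\ outdeg u = outdeg v.

Definition totally_regular : Prop :=
  out_regular /\ forall u, indeg u = outdeg u.

End MixedGraphs.

(* Indexed so that F_0 = F_1 = 1. *)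
Fixpoint fib (n : nat) : nat :=
  match n with
  | 0 => 1
  | m.+1 => if m is l.+1 then fib m + fib l else 1
  end.

(* The mixed Moore bound M(1,1,k); the subtraction never truncates. *)
Definition moore11 (k : nat) : nat := fib (k + 3) - 2.

(* (1,1,k;-1)-graphs *)
Definition almost_moore11 (V : finType) (G : mixed_graph V) (k : nat) : Prop :=
  [/\ proper_mixed G, max_deg G = 1, max_outdeg G = 1, is_diameter G k
    & #|V| = moore11 k - 1].

(* Main.v *)
Require Import Defs.
From mathcomp Require Import all_boot.
From mathcomp Require Import zify.

Set Implicit Arguments.
Unset Strict Implicit.
Unset Printing Implicit Defensive.

(** A vertex has at most one edge and at most one out-arc, so edges define an
involution [s] and arcs a map [f] (identities where there is nothing to
follow), and a walk is a starting vertex together with a word in the two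
letters [s] and [f]. Cancelling [ss] shows that the reduced words of length at
most [k] lead from any vertex to all vertices. There are M(1,1,k) = fib (k+3) - 2
of them, one more than there are vertices. Two consequences follow at once.
If [s] or [f] had a fixed point [u], a far smaller set of words would cover the
graph from [u] ([s_nofix], [f_nofix]), so the graph is out-regular. And for
every [x] at most one vertex is the end of two different words from [x]
([repeats_uniq]).

It remains to see that [f] is injective. Let [v] be a source, that is, a vertex
that is not a value of [f]. Walks to [v] must enter through its mate [s v], so
every vertex reaches [s v] within [k-1] steps. Comparing, for a matched pair
{u, s u}, the walk that starts along the edge with the walk that starts along
an arc shows that [s v] is the repeated vertex of [u] or of [s u]. A single
pair thus accommodates at most two sources ([card_sources]).

Choose one in-arc at each vertex that has one, and call the other arcs extra;
there are as many extra arcs as sources. Along arcs that are not extra, walks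
can be traced back uniquely, so at most M(1,1,j) vertices reach a given vertex
in [j] steps in this way. A walk of length at most [k-1] to [s v] that ends with
an arc has a first arc that is extra or enters [s v]; the part before it is at
most [k-2] long, and at most [k-3] if the arc does not enter [s v]. With [d]
arcs into [s v] and [e] extra arcs elsewhere this gives
|V| <= 2 + d M(1,1,k-2) + e M(1,1,k-3) ([card_marked]). If only one extra arc
entered [s v], then d <= 2, and with at most two extra arcs in all the right-hand
side is at most 2 fib (k+1) + fib k - 4 = |V| - 1, a contradiction. So at least
two extra arcs enter the mate of every source; as mates are distinct and extra
arcs are equinumerous with sources, there are no sources and no extra arcs. *)

(** * Reduced words *)

Notation word := (seq bool).

(** The letter [true] stands for an edge and [false] for an arc. An edge
followed by an edge leads back, so no two letters [true] are adjacent. *)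
Definition reduced (w : word) : bool := sorted (fun b c => ~~ (b && c)) w.

(** The inner match is [arc_words i] unfolded, which keeps the recursion
structural; see [wordsS]. *)
Fixpoint words (j : nat) : seq word :=
  if j is i.+1 then
    [::] :: map (cons false) (words i) ++
      map (cons true)
        ([::] :: if i is h.+1 then map (cons false) (words h) else [::])
  else [:: [::]].

(** The words that may follow an edge. *)
Definition arc_words (j : nat) : seq word :=
  [::] :: if j is i.+1 then map (cons false) (words i) else [::].

Lemma fibSS n : fib n.+2 = fib n.+1 + fib n.
Proof. by []. Qed.

Lemma fib_gt0 n : 0 < fib n.
Proof.
suff: (0 < fib n) && (0 < fib n.+1) by case/andP.
by elim: n => // n /andP[n0 n1]; rewrite n1 fibSS addn_gt0 n1.
Qed.

Lemma wordsS j : words j.+1 = arc_words j.+1 ++ map (cons true) (arc_words j).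
Proof. by []. Qed.

(** The mixed Moore bound. *)
Lemma size_words j : size (words j) + 2 = fib (j + 3).
Proof.
suff: (size (words j) + 2 = fib (j + 3)) /\
      (size (words j.+1) + 2 = fib (j.+1 + 3)) by case.
elim: j => [|j [IH0 IH1]]; first by [].
split=> //; move: IH0 IH1; rewrite !addn3 [fib j.+2.+3]fibSS => <- <-.
rewrite wordsS size_cat size_map /arc_words /= !size_map; lia.
Qed.

Lemma words_mono i j : i <= j -> size (words i) <= size (words j).
Proof.
move=> /subnKC <-; elim: (j - i) => [|m IH]; first by rewrite addn0.
rewrite addnS; apply: (leq_trans IH).
have := size_words (i + m); have := size_words (i + m).+1.
rewrite !addn3 [fib (i + m).+1.+3]fibSS; lia.
Qed.

Lemma mem_words_arc_words j w : size w <= j ->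
  (reduced w -> w \in words j) /\ (reduced (true :: w) -> w \in arc_words j).
Proof.
elim: w j => [|b w IH] j sw; first by case: j {sw}.
case: j sw => // j sw.
have [IHw IHa] := IH j sw.
have arcs : reduced (false :: w) -> false :: w \in arc_words j.+1.
  by move=> /path_sorted /IHw rw; rewrite inE map_f.
rewrite wordsS mem_cat; case: b {sw}; split=> // rw.
- by apply/orP; right; apply: map_f; apply: IHa.
- by rewrite arcs.
Qed.

Lemma mem_words j w : reduced w -> size w <= j -> w \in words j.
Proof. by move=> rw /mem_words_arc_words[/(_ rw)]. Qed.

Lemma mem_arc_words j w :
  reduced (true :: w) -> size w <= j -> w \in arc_words j.
Proof. by move=> rw /mem_words_arc_words[_ /(_ rw)]. Qed.

(** * Walks along an involution and a map *)

Section Action.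

Variables (V : finType) (s f : V -> V).

Definition move (x : V) (b : bool) : V := if b then s x else f x.
Definition run (x : V) (w : word) : V := foldl move x w.

Lemma reduce_word x w : involutive s ->
  exists w', [/\ reduced w', size w' <= size w & run x w' = run x w].
Proof.
move=> sK; elim: w x => [|b w IH] x; first by exists [::].
have [w' [rw sw ew]] := IH (move x b).
case: b ew => ew; last first.
  exists (false :: w'); split=> //.
  by case: w' rw {sw ew}.
case: w' rw sw ew => [|[] w'] rw sw ew.
- by exists [:: true].
- exists w'; split; [exact: path_sorted rw | by move: sw => /=; lia |].
  by rewrite -[RHS]ew /= sK.
- by exists [:: true, false & w'].
Qed.

(** The lower bound on the number of words behind every counting argument
below: words that reach everything are at least as many as the vertices. *)
Lemma card_run x (L : seq word) :
  (forall z, exists2 w, w \in L & run x w = z) -> #|V| <= size L.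
Proof.
move=> cov; rewrite cardE -(size_map (run x) L).
apply: uniq_leq_size (enum_uniq _) _ => z _.
by have [w wL <-] := cov z; apply: map_f.
Qed.

(** * Counting words that start at a vertex *)

Variable k : nat.
Hypotheses (sK : involutive s) (k3 : 3 <= k).
Hypothesis reach :
  forall x z, exists w, [/\ reduced w, size w <= k & run x w = z].
Hypothesis cardV : #|V| + 3 = fib (k + 3).

(** If [s] fixes [x], an initial edge letter can be deleted, so the words not
starting with an edge already cover: only M(1,1,k-1) + 1 of them. *)
Lemma s_nofix x : s x != x.
Proof.
apply/eqP => sx.
have : #|V| <= size (arc_words k).
  apply: (@card_run x) => z; have [w [rw sw ew]] := reach x z.
  case: w rw sw ew => [|[] w] rw sw ew.
  - by exists [::].
  - exists w; last by rewrite -ew /= sx.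
    by apply: mem_arc_words => //; move: sw => /=; lia.
  - by exists (false :: w) => //; apply: mem_arc_words.
have [i ki] : exists i, k = i.+2 by exists k.-2; lia.
have := size_words i.+1; move: cardV k3; rewrite ki /= !size_map !addn3.
have := fibSS i.+3; have := fibSS i.+1; have := fibSS i.
have := fib_gt0 i; have := fib_gt0 i.+1; lia.
Qed.

(** If [f] fixes [x], initial arc letters can be deleted, so the empty word
and the words starting with an edge already cover: only M(1,1,k-2) + 2. *)
Lemma f_nofix x : f x != x.
Proof.
apply/eqP => fx.
have : #|V| <= size ([::] :: map (cons true) (arc_words k.-1)).
  apply: (@card_run x) => z; have [w [rw sw ew]] := reach x z.
  elim: w rw sw ew => [|[] w IH] rw sw ew.
  - by exists [::].
  - exists (true :: w) => //; rewrite inE map_f // mem_arc_words //.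
    by move: sw => /=; lia.
  - apply: IH; [exact: path_sorted rw | by move: sw => /=; lia |].
    by rewrite -ew /= fx.
have [i ki] : exists i, k = i.+3 by exists (k - 3); lia.
have := size_words i.+1; move: cardV; rewrite ki /= !size_map !addn3.
have := fibSS i.+4; have := fibSS i.+3; have := fibSS i.+2.
have := fibSS i.+1; have := fibSS i; have := fib_gt0 i.
have := fib_gt0 i.+1; lia.
Qed.

Definition repeats x z :=
  exists w1 w2, [/\ w1 \in words k, w2 \in words k, w1 != w2,
                    run x w1 = z & run x w2 = z].

(** Two different repeated ends would let two words be dropped without losing
a vertex, but there is only one word too many. *)
Lemma repeats_uniq x y z : repeats x y -> repeats x z -> y = z.
Proof.
move=> [w1 [w2 [L1 L2 n12 e1 e2]]] [w3 [w4 [L3 L4 n34 e3 e4]]].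
apply/eqP/negPn/negP => yz.
have n14 : w1 != w4 by apply: contraNneq yz => E; rewrite -e1 -e4 E.
have n24 : w2 != w4 by apply: contraNneq yz => E; rewrite -e2 -e4 E.
have n23 : w2 != w3 by apply: contraNneq yz => E; rewrite -e2 -e3 E.
(* [w1] and [w3] replace the dropped words [w2] and [w4]. *)
have p2 := perm_to_rem L2.
have L4' : w4 \in rem w2 (words k).
  by move: L4; rewrite (perm_mem p2) inE eq_sym (negPf n24).
have p4 := perm_to_rem L4'.
have inL w : w \in words k -> w != w2 -> w != w4 ->
    w \in rem w4 (rem w2 (words k)).
  move=> Lw nw2 nw4; move: Lw.
  by rewrite (perm_mem p2) inE (negPf nw2) (perm_mem p4) inE (negPf nw4).
have : #|V| <= size (rem w4 (rem w2 (words k))).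
  apply: (@card_run x) => t; have [w [rw sw ew]] := reach x t.
  have Lw := mem_words rw sw.
  have [E2|nw2] := eqVneq w w2.
    by exists w1; [apply: inL | rewrite e1 -ew E2].
  have [E4|nw4] := eqVneq w w4.
    by exists w3; [apply: inL; rewrite // eq_sym | rewrite e3 -ew E4].
  by exists w; first exact: inL.
have := perm_size p2; have := perm_size p4; have := size_words k; move: cardV.
by rewrite /=; lia.
Qed.

(** * At most two sources *)

Definition sources : {set V} := [set v | [forall p, f p != v]].

(** A word leading to a source from elsewhere ends with an edge; deleting this
last letter gives a word to the mate that is shorter and, being reduced before
the deletion, does not end with an edge. *)
Lemma reach_mate v x : v \in sources -> x != v ->
  exists w, [/\ reduced w, size w < k, last false w = false & run x w = s v].
Proof.
rewrite inE => /forallP Sv xv; have [w [rw sw ew]] := reach x v.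
case/lastP: w rw sw ew => [|w b] rw sw ew; first by rewrite -ew eqxx in xv.
move: ew; rewrite /run foldl_rcons -/(run x w); case: b rw sw => rw sw ew; last first.
  by have := Sv (run x w); rewrite -[X in _ != X]ew eqxx.
exists w; split.
- by move: rw; rewrite -cats1 => /cat_sorted2[].
- by move: sw; rewrite size_rcons.
- move: rw; case/lastP: w {sw ew} => // w c; rewrite last_rcons.
  by rewrite /reduced -!cats1 -catA => /cat_sorted2[_]; case: c.
- by rewrite -ew /= sK.
Qed.

(** The source itself reaches its mate by its edge. *)
Lemma reach_mate_all v x : v \in sources ->
  exists w, [/\ reduced w, size w < k & run x w = s v].
Proof.
move=> Sv; have [->|xv] := eqVneq x v.
  by exists [:: true]; split => //=; lia.
by have [w [rw sw _ ew]] := reach_mate Sv xv; exists w.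
Qed.

(** Every vertex has a word to [s v] of length at most [k] starting with an
arc, obtained through its image under [f]. One of [u], [s u] also has such a
word starting with an edge: take a word of length less than [k] from [u]; if it
does not itself start with an edge, precede it by the edge from [s u]. *)
Lemma edge_repeats v u : v \in sources ->
  repeats u (s v) \/ repeats (s u) (s v).
Proof.
move=> Sv.
have arcw x : exists w, [/\ reduced (false :: w), size (false :: w) <= k
    & run x (false :: w) = s v].
  have [w [rw sw ew]] := reach_mate_all (f x) Sv.
  by exists w; split => //; case: w rw {sw ew}.
have conc x w : reduced (true :: w) -> size (true :: w) <= k ->
    run x (true :: w) = s v -> repeats x (s v).
  move=> rw sw ew; have [w' [rw' sw' ew']] := arcw x.
  by exists (true :: w), (false :: w'); split => //; apply: mem_words.
have [w [rw sw ew]] := reach_mate_all u Sv.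
case: w rw sw ew => [|[] w] rw sw ew.
- by right; apply: (conc _ [::]); rewrite //= ?sK //; lia.
- by left; apply: (conc _ w) => //; apply: ltnW.
- by right; apply: (conc _ (false :: w)) => //; rewrite /= sK.
Qed.

(** Three sources have three different mates, each repeated from one of the
two ends of the same edge; then some end would repeat two vertices. *)
Lemma card_sources : #|sources| <= 2.
Proof.
rewrite leqNgt; apply/negP => /card_gt2P[v1 [v2 [v3 [[S1 S2 S3] [n12 n23 n31]]]]].
have sI : injective s := can_inj sK.
have absurd x a b : a != b -> repeats x (s a) -> ~ repeats x (s b).
  by move=> /eqP ab ra rb; apply: ab; apply: sI; apply: repeats_uniq ra rb.
(* Any vertex would do in place of the first argument [v1]. *)
have := edge_repeats v1 S1; have := edge_repeats v1 S2.
have := edge_repeats v1 S3.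
have A12 x := absurd x _ _ n12.
have A23 x := absurd x _ _ n23.
have A31 x := absurd x _ _ n31.
by move=> [h3|h3] [h2|h2] [h1|h1];
  solve [case: (A12 _ h1 h2) | case: (A23 _ h2 h3) | case: (A31 _ h3 h1)].
Qed.

(** * Counting words that end at a vertex *)

(** The chosen representative of the fibre of [f] through [p]. *)
Definition rep p := odflt p [pick q | f q == f p].
(** An arc is identified with its tail: [p] stands for the arc from [p] to
[f p]. *)
Definition extra : {set V} := [set p | rep p != p].

Lemma f_rep p : f (rep p) = f p.
Proof. by rewrite /rep; case: pickP => //= q /eqP. Qed.

Lemma rep_eq p q : f p = f q -> rep p = rep q.
Proof.
move=> E; rewrite /rep (eq_pick (Q := fun r => f r == f q)); last first.
  by move=> r; rewrite /= E.
by case: pickP => //= /(_ q); rewrite eqxx.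
Qed.

Lemma f_inj_nonextra p q : p \notin extra -> q \notin extra ->
  f p = f q -> p = q.
Proof.
by rewrite !inE !negbK => /eqP {2}<- /eqP {2}<-; apply: rep_eq.
Qed.

(** Each value of [f] has exactly one arc that is not extra, so there are
|V| - |sources| arcs that are not extra. *)
Lemma card_extra : #|extra| = #|sources|.
Proof.
have : f @: (~: extra) = ~: sources.
  apply/setP => y; rewrite !inE negb_forall; apply/imsetP/existsP.
    by move=> [p _ ->]; exists p; rewrite negbK.
  move=> [p]; rewrite negbK => /eqP <-; exists (rep p); last by rewrite f_rep.
  by rewrite !inE negbK; apply/eqP/rep_eq/f_rep.
move=> /(congr1 (fun A : {set V} => #|A|)).
rewrite card_in_imset; last first.
  by move=> p q; rewrite !in_setC; apply: f_inj_nonextra.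
move=> E; have := cardsC extra; have := cardsC sources; rewrite E; lia.
Qed.

(** The walk from [x] along [w] uses no extra arc. *)
Fixpoint clean (x : V) (w : word) : bool :=
  if w is b :: w' then (b || (x \notin extra)) && clean (move x b) w' else true.

(** Without extra arcs a walk is determined by its word and its end, which is
what makes backward counting obey the Moore bound. *)
Lemma clean_inj w x y : clean x w -> clean y w -> run x w = run y w -> x = y.
Proof.
elim: w x y => [|b w IH] x y //= /andP[bx cx] /andP[by_ cy] E.
have := IH _ _ cx cy E; case: b bx by_ {cx cy E} => /= [_ _|].
  exact: (can_inj sK).
exact: f_inj_nonextra.
Qed.

Definition in_ball j p : {set V} :=
  [set x | has (fun w => clean x w && (run x w == p)) (words j)].

Lemma card_in_ball j p : #|in_ball j p| <= size (words j).
Proof.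
rewrite /in_ball; elim: (words j) => [|w L IH] /=.
  by rewrite (_ : [set x | _] = set0) ?cards0 //; apply/setP => x; rewrite !inE.
rewrite -add1n; set A := [set x | clean x w && (run x w == p)].
apply: (@leq_trans #|A :|: [set x | has (fun w => clean x w && (run x w == p)) L]|).
  by apply: subset_leq_card; apply/subsetP => x; rewrite !inE.
apply: leq_trans (leq_card_setU _ _) _; apply: leq_add IH.
apply/card_le1P => x; rewrite inE => /andP[cx /eqP ex] y; rewrite !inE.
apply/andP/eqP => [[cy /eqP ey]|-> //]; last by rewrite ex.
by apply: (clean_inj (w := w)) => //; rewrite ex.
Qed.

(** Cutting a walk to [z] before its first arc that is extra or enters [z].
Such an arc exists, since the last step enters [z]. The default [false] of
[last] makes its hypothesis say that [w] does not end with an edge. *)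
Lemma first_marked z x w : w != [::] -> last false w = false -> run x w = z ->
  exists w1 w2, [/\ w = w1 ++ false :: w2, clean x w1,
    (run x w1 \in extra) || (f (run x w1) == z)
    & run (f (run x w1)) w2 = z].
Proof.
elim: w x => [|b w IH] x //= _ lw ew.
case: (boolP (~~ b && ((x \in extra) || (f x == z)))) => [/andP[nb mx]|].
  by case: b nb lw ew => // _ lw ew; exists [::], w.
rewrite negb_and negbK negb_or => mb.
have w0 : w != [::].
  case: w ew lw {IH} => //= ew lw; rewrite lw /= in mb ew *.
  by rewrite -ew eqxx andbF in mb.
have lw' : last false w = false by case: w w0 lw {IH ew}.
have [w1 [w2 [E c m r]]] := IH _ w0 lw' ew.
exists (b :: w1), w2; split => //; first by rewrite E.
by rewrite /= c andbT; case: b mb {lw ew c m r} => //= /andP[].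
Qed.

(** Vertices other than [v] and [s v] are sorted by the tail of the first arc,
on a walk to [s v], that is extra or enters [s v]. An arc that does not enter
[s v] leaves at least one more step to be made, hence the radius [k - 3]. *)
Lemma card_marked v : v \in sources ->
  #|V| <= 2 + #|[set p | f p == s v]| * size (words (k - 2))
            + #|[set p in extra | f p != s v]| * size (words (k - 3)).
Proof.
move=> Sv; set In := [set p | f p == s v]; set Ex := [set p in extra | _].
pose U1 := \bigcup_(p in In) in_ball (k - 2) p.
pose U2 := \bigcup_(p in Ex) in_ball (k - 3) p.
have cU (A : {set V}) j :
    #|\bigcup_(p in A) in_ball j p| <= #|A| * size (words j).
  rewrite -sum_nat_const; apply: (@leq_trans (\sum_(p in A) #|in_ball j p|)).
    2: by apply: leq_sum => p _; apply: card_in_ball.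
  elim/big_rec2: _ => [|p m B _ IH]; first by rewrite cards0.
  by apply: leq_trans (leq_card_setU _ _) _; rewrite leq_add2l.
have sub : [set: V] \subset [set v; s v] :|: U1 :|: U2.
  apply/subsetP => x _; rewrite !inE.
  have [//|xv] := eqVneq x v.
  have [//|xsv] := eqVneq x (s v).
  have [w [rw sw lw ew]] := reach_mate Sv xv.
  have w0 : w != [::].
    by apply: contraNneq xsv => E; rewrite E /= in ew; rewrite ew.
  have [w1 [w2 [E c m r]]] := first_marked w0 lw ew.
  have ball j : size w1 <= j -> x \in in_ball j (run x w1).
    move=> sj; rewrite inE; apply/hasP; exists w1; last by rewrite c eqxx.
    by apply: mem_words => //; move: rw; rewrite E => /cat_sorted2[].
  move: sw; rewrite E size_cat /= => sw.
  have [fsv|fsv] := eqVneq (f (run x w1)) (s v).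
    apply/orP; left; apply/bigcupP; exists (run x w1); first by rewrite inE fsv.
    by apply: ball; lia.
  apply/orP; right; apply/bigcupP; exists (run x w1).
    by rewrite inE fsv andbT; move: m; rewrite (negPf fsv) orbF.
  apply: ball; case: w2 r sw {E} => [|b w2] /= r; last by lia.
  by rewrite r eqxx in fsv.
have := subset_leq_card sub; rewrite cardsT => /leq_trans; apply.
apply: leq_trans (leq_card_setU _ _) _; apply: leq_add; last exact: cU.
apply: leq_trans (leq_card_setU _ _) _; apply: leq_add; last exact: cU.
by rewrite cards2; case: (_ != _).
Qed.

(** With [c] extra arcs among the [d] arcs into [s v] and [e] elsewhere,
[d <= c + 1] and [c + e <= 2]; if [c <= 1], the right-hand side of
[card_marked] is largest for c = e = 1, and is still below |V|. *)
Lemma two_extra v : v \in sources -> 1 < #|[set p in extra | f p == s v]|.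
Proof.
move=> Sv; rewrite ltnNge; apply/negP => c1.
have := card_marked Sv.
set d := #|[set p | f p == s v]|; set e := #|[set p in extra | f p != s v]|.
set c := #|_| in c1.
have ce : c + e <= 2.
  apply: leq_trans card_sources; rewrite -card_extra.
  rewrite -(cardsID [set p | f p == s v] extra) leq_add //.
    by apply: subset_leq_card; apply/subsetP => p; rewrite !inE.
  by apply: subset_leq_card; apply/subsetP => p; rewrite !inE andbC.
have dc : d <= c + 1.
  rewrite /d -(cardsID extra) leq_add //.
    by apply: subset_leq_card; apply/subsetP => p; rewrite !inE andbC.
  apply/card_le1P => p; rewrite in_setD inE => /andP[pe /eqP fp] q.
  rewrite in_setD inE [RHS]inE; apply/andP/eqP => [[qe /eqP fq]|->].
    by apply: f_inj_nonextra => //; rewrite fp.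
  by rewrite fp eqxx.
have [i ki] : exists i, k = i.+3 by exists (k - 3); lia.
have -> : k - 2 = i.+1 by lia.
have -> : k - 3 = i by lia.
have := size_words i; have := size_words i.+1; have := words_mono (leqnSn i).
have := fibSS i.+4; have := fibSS i.+3.
move: cardV; rewrite ki !addn3; nia.
Qed.

(** The map sending an arc to the mate of its head has at least two extra arcs
over each source, while extra arcs and sources are equally many. *)
Lemma sources0 : sources = set0.
Proof.
apply/eqP; rewrite -cards_eq0 -leqn0.
suff : 2 * #|sources| <= #|extra| by rewrite card_extra; lia.
rewrite mulnC -sum_nat_const.
apply: (@leq_trans #|[set p in extra | s (f p) \in sources]|); last first.
  by apply: subset_leq_card; apply/subsetP => p; rewrite inE => /andP[].
rewrite -[X in _ <= X]sum1_card.
rewrite [X in _ <= X](partition_big (fun p => s (f p)) (mem sources)) /=.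
  2: by move=> p; rewrite inE => /andP[].
apply: leq_sum => v Sv; apply: (leq_trans (two_extra Sv)); rewrite sum1_card.
apply: subset_leq_card; apply/subsetP => p; rewrite inE => /andP[pe /eqP fp].
by rewrite -topredE /= inE pe fp sK Sv eqxx.
Qed.

Lemma f_inj : injective f.
Proof.
have E0 : extra = set0 by apply/eqP; rewrite -cards_eq0 card_extra sources0 cards0.
by move=> p q; apply: f_inj_nonextra; rewrite E0 inE.
Qed.

Lemma card_preim y : #|[set p | f p == y]| = 1.
Proof.
have : y \notin sources by rewrite sources0 inE.
rewrite inE negb_forall => /existsP[p]; rewrite negbK => /eqP <-.
rewrite -[RHS](cards1 p); congr #|pred_of_set _|.
by apply/setP => q; rewrite !inE (inj_eq f_inj).
Qed.

End Action.

(** * From mixed graphs to maps *)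

Section Selection.

Variables (V : finType) (e : rel V).

(** The fallback [u] is harmless: a letter that stays in place never hurts
reachability, and fixed points are excluded afterwards by counting. *)
Definition follow u := odflt u [pick v | e u v].

Lemma follow_eq u v : #|[set w | e u w]| <= 1 -> e u v -> follow u = v.
Proof.
move=> /card_le1_eqP le1 uv; rewrite /follow.
by case: pickP => [w uw|/(_ v)]; [apply: le1; rewrite inE | rewrite uv].
Qed.

Lemma follow_neq u : follow u != u -> e u (follow u).
Proof. by rewrite /follow; case: pickP => //= _; rewrite eqxx. Qed.

Lemma follow_rel u v : #|[set w | e u w]| <= 1 -> follow u != u ->
  e u v = (follow u == v).
Proof.
move=> le1 nu; apply/idP/eqP => [|<-]; first exact: follow_eq.
exact: follow_neq.
Qed.

End Selection.

(** * Total regularity *)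

Theorem theorem3p5 (k : nat) (V : finType) (G : mixed_graph V) :
  3 <= k -> almost_moore11 G k -> totally_regular G.
Proof.
move=> k3 [_ dG aG [dist _] cV].
have d1 u : #|[set v | edge G u v]| <= 1.
  by rewrite -dG; apply: (leq_bigmax (F := deg G)).
have a1 u : #|[set v | Defs.arc G u v]| <= 1.
  by rewrite -aG; apply: (leq_bigmax (F := outdeg G)).
pose s := follow (edge G); pose f := follow (Defs.arc G).
have sK : involutive s.
  move=> u; have [E|nu] := eqVneq (s u) u; first by rewrite !E.
  by apply: follow_eq (d1 _) _; rewrite edge_sym; apply: follow_neq.
have reach x z : exists w, [/\ reduced w, size w <= k & run s f x w = z].
  have [n [[p [pp lp sp]] _] nk] := dist x z.
  have [w sw ew] : exists2 w, size w = n & run s f x w = z.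
    elim: p x n pp lp sp {nk} => [|y p IH] x n /=; first by exists [::].
    case/andP=> xy pp lp sp; have [w sw ew] := IH y _ pp lp erefl.
    case/orP: xy => xy.
      by exists (true :: w); rewrite /= ?sw // [s x](follow_eq _ xy).
    by exists (false :: w); rewrite /= ?sw // [f x](follow_eq _ xy).
  have [w' [rw sw' ew']] := reduce_word f x w sK.
  by exists w'; split; [|rewrite (leq_trans sw') ?sw|rewrite ew'].
have cardV : #|V| + 3 = fib (k + 3).
  rewrite cV /moore11; have := size_words 3; have := size_words k.
  have := words_mono k3; rewrite [fib (3 + 3)]/=; lia.
have eE u v := follow_rel v (d1 u) (s_nofix k3 reach cardV u).
have aE u v := follow_rel v (a1 u) (f_nofix k3 reach cardV u).
have card_eq (y : V) : #|[set v | y == v]| = 1.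
  by rewrite -[RHS](cards1 y); apply: eq_card => v; rewrite !inE eq_sym.
have degE u : deg G u = 1.
  by rewrite -[RHS](card_eq (s u)); apply: eq_card => v; rewrite !inE eE.
have outE u : outdeg G u = 1.
  by rewrite -[RHS](card_eq (f u)); apply: eq_card => v; rewrite !inE aE.
split=> [u v|u]; first by rewrite !degE !outE.
rewrite outE -(card_preim sK k3 reach cardV u); apply: eq_card => v.
by rewrite !inE aE.
Qed.
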